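(* Let $q\ge 2$ be an integer and let $T=T_q$ be the $q$-valent rooted tree. Let $D$ be a countable descendant-homogeneous digraph in which the descendant set ${\rm desc}(v)$ of every vertex $v$ is isomorphic to $T$. Then $D$ is isomorphic to $D_n$ for some $n\in\{2,3,\ldots\}\cup\{\infty\}$.
   Context: Digraphs have vertex set $VD$ and set of directed edges $ED\subseteq VD\times VD$; ''subdigraph'' means full induced subdigraph, and embeddings are embeddings onto induced subdigraphs. For $s\ge0$, an $s$-arc from $u_0$ to $u_s$ is a sequence $u_0u_1\ldots u_s$ of vertices with $(u_i,u_{i+1})\in ED$ for $0\le i<s$ and $u_{i-1}\ne u_{i+1}$ for $0<i<s$. ${\rm desc}^s(u)$ is the set of vertices $v$ such that there is an $s$-arc from $u$ to $v$, ${\rm desc}(u)=\bigcup_{s\ge0}{\rm desc}^s(u)$ (so $u\in{\rm desc}(u)$), and ${\rm desc}(X)=\bigcup_{x\in X}{\rm desc}(x)$. A subset $A$ of a digraph $E$ is descendant-closed ($A\le E$) if ${\rm desc}_E(a)\subseteq A$ for all $a\in A$; it is finitely generated if $A={\rm desc}_E(X)$ for some finite $X$. A $\le$-embedding is an embedding $f:A\to B$ with $f(A)\le B$. A countable digraph is descendant-homogeneous if every isomorphism between finitely generated descendant-closed subdigraphs extends to an automorphism. $T=T_q$ is the digraph whose vertices are the finite sequences over $\{0,\ldots,q-1\}$ with edges $(\bar w,\bar wi)$. Let $\mathcal C$ be the class of digraphs $A$ such that ${\rm desc}(a)\cong T$ for all $a\in A$, $A={\rm desc}(X)$ for some finite $X$,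 and ${\rm desc}(a)\cap{\rm desc}(b)$ is finitely generated for all $a,b\in A$. For $n\ge2$, $\mathcal T_n$ is the member of $\mathcal C$ generated by $n$ vertices $x_1,\ldots,x_n$ with ${\rm desc}^1(x_i)={\rm desc}^1(x_j)$ for all $i,j$ (i.e. $n$ roots sharing the same $q$ out-neighbours, each of which has descendant set a copy of $T$, these copies being disjoint). $\mathcal C_n$ is the class of $A\in\mathcal C$ such that there is no $\le$-embedding of $\mathcal T_n$ into $A$; put $\mathcal C_\infty=\mathcal C$. For $n\in\{2,\ldots,\infty\}$, $D_n$ denotes the (unique up to isomorphism) countable descendant-homogeneous digraph whose finitely generated descendant-closed subdigraphs are, up to isomorphism, exactly the members of $\mathcal C_n$ (its Fraïssé limit). *)

(* Defs.v *)
From mathcomp Require Import all_boot.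
Set Implicit Arguments. Unset Strict Implicit. Unset Printing Implicit Defensive.

Record digraph := Digraph { vert :> Type; edge : vert -> vert -> Prop }.

Section Digraphs.
Variable D : digraph.

Fixpoint is_arc (l : seq D) : Prop :=
  match l with
  | a :: ((b :: c :: _) as t) => edge a b /\ a <> c /\ is_arc t
  | [:: a; b] => edge a b
  | _ => True
  end.

Definition desc (u v : D) : Prop :=
  exists l : seq D, is_arc (u :: l) /\ last u l = v.

Definition descS (X : D -> Prop) (v : D) : Prop := exists2 x, X x & desc x v.

Definition desc_closed (A : D -> Prop) : Prop :=
  forall a, A a -> forall v, desc a v -> A v.

Definition fin_gen (A : D -> Prop) : Prop :=
  exists (k : nat) (g : 'I_k -> D), forall v, A v <-> exists i, desc (g i) v.

End Digraphs.

Definition sub (D : digraph) (A : D -> Prop) : digraph :=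
  @Digraph {v : D | A v} (fun x y => edge (proj1_sig x) (proj1_sig y)).

Definition is_iso (G H : digraph) (f : G -> H) : Prop :=
  exists g : H -> G, cancel f g /\ cancel g f /\
    forall x y, edge (f x) (f y) <-> edge x y.

Definition iso (G H : digraph) : Prop := exists f : G -> H, is_iso f.

Definition countable_digraph (D : digraph) : Prop :=
  exists f : D -> nat, injective f.

Definition desc_homogeneous (D : digraph) : Prop :=
  forall (A B : D -> Prop), desc_closed A -> fin_gen A ->
    desc_closed B -> fin_gen B ->
    forall phi : sub A -> sub B, is_iso phi ->
      exists sigma : D -> D, is_iso sigma /\
        forall x : sub A, sigma (proj1_sig x) = proj1_sig (phi x).

Definition Ttree (q : nat) : digraph :=
  @Digraph (seq 'I_q) (fun w v => exists i : 'I_q, v = rcons w i).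

Definition inC (q : nat) (A : digraph) : Prop :=
  [/\ forall a : A, iso (sub (desc a)) (Ttree q),
      fin_gen (fun _ : A => True) &
      forall a b : A, fin_gen (fun v => desc a v /\ desc b v)].

(* the digraph script-T_n: n roots (inl r) sharing q out-neighbours
   (inr (i, [::])), below which hang disjoint copies of T_q *)
Definition Tn (q n : nat) : digraph :=
  @Digraph ('I_n + ('I_q * seq 'I_q))%type
    (fun x y => match x, y with
                | inl _, inr (i, w) => w = [::]
                | inr (i, w), inr (j, w') => j = i /\ exists k : 'I_q, w' = rcons w k
                | _, _ => False
                end).

Definition le_embedding (G H : digraph) (f : G -> H) : Prop :=
  [/\ injective f, forall x y, edge (f x) (f y) <-> edge x y &
      desc_closed (fun v => exists x, f x = v)].

(* n : option nat, None standing for infinity *)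
Definition inCn (q : nat) (n : option nat) (A : digraph) : Prop :=
  inC q A /\
  match n with
  | None => True
  | Some n => ~ exists f : Tn q n -> A, le_embedding f
  end.

Definition age_is (q : nat) (n : option nat) (D : digraph) : Prop :=
  (forall A : D -> Prop, desc_closed A -> fin_gen A -> inCn q n (sub A)) /\
  (forall A : digraph, inCn q n A ->
     exists2 B : D -> Prop, desc_closed B /\ fin_gen B & iso (sub B) A).

(* D is isomorphic to D_n: D is a countable descendant-homogeneous digraph
   with age C_n (i.e. D is "a" D_n) and is isomorphic to every such digraph. *)
Definition iso_to_Dn (q : nat) (n : option nat) (D : digraph) : Prop :=
  age_is q n D /\
  forall E : digraph, countable_digraph E -> desc_homogeneous E ->
    age_is q n E -> iso D E.

(* Main.v *)
Require Import Defs.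
From mathcomp Require Import all_boot perm boolp.

Set Implicit Arguments.
Unset Strict Implicit.
Unset Printing Implicit Defensive.

(** The descendant sets of two vertices of [D] meet in a finitely generated set:
    otherwise a diagonal argument gives an automorphism of [desc a] moving
    [desc a] /\ [desc b] away from every [desc a] /\ [desc d]; by homogeneity it
    extends to [D], and the image of [b] is a contradiction.  Here countability
    of [D] is used.

    A digraph [A] of the class C is obtained from finitely many disjoint trees
    by adding finitely many vertices one at a time, above [q] vertices with
    disjoint descendant sets.  Disjoint trees can always be found in [D]: every
    finitely generated set is, up to finitely many vertices, below a single
    vertex [p], and [p] has a sibling.  If [D] contains T_m and [A] does not
    contain T_(m+1), a new vertex can be added too: by homogeneity [m] vertices
    of [D] have the prescribed children, and they cannot all be images of
    vertices of [A].  Hence the age of [D] is C_n with [n] the least number such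
    that T_n does not embed in [D], and back-and-forth gives uniqueness. *)

(** * Reachability and finitely generated sets *)

Section Reachability.
Variable G : digraph.
Implicit Types (u v w a b x y : G) (A P : G -> Prop).

Lemma is_arc_behead u l : is_arc (u :: l) -> is_arc l.
Proof. by case: l => [|w [|c l]] //= [_ []]. Qed.

Lemma desc_refl u : desc u u.
Proof. by exists [::]. Qed.

(* A walk that backtracks is shortened, so [desc] is plain reachability. *)
Lemma desc_step u w v : edge u w -> desc w v -> desc u v.
Proof.
move=> uw [[|c l] [arcl lastl]]; first by exists [:: w].
case: (pselect (u = c)) => [uc|nuc].
  by exists l; rewrite uc; split=> //; apply: is_arc_behead arcl.
by exists [:: w, c & l].
Qed.

Lemma desc_ind (R : G -> G -> Prop) :
  (forall u, R u u) ->
  (forall u w v, edge u w -> desc w v -> R w v -> R u v) ->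
  forall u v, desc u v -> R u v.
Proof.
move=> R0 RS u v [l [arcl <-]]; elim: l u arcl => [|w l IH] u arcl //=.
have arcw := is_arc_behead arcl.
apply: (RS u w); [|by exists l|exact: IH].
by case: l arcl {IH arcw} => [|c l] //= [].
Qed.

Lemma desc_edge u v : edge u v -> desc u v.
Proof. by move=> uv; apply: desc_step uv (desc_refl v). Qed.

Lemma desc_trans u v w : desc u v -> desc v w -> desc u w.
Proof.
move=> uv; elim/desc_ind: uv w => // {}u x {}v ux _ IH w vw.
exact: desc_step ux (IH _ vw).
Qed.

Lemma desc_closedP A :
  desc_closed A <-> forall a b, A a -> edge a b -> A b.
Proof.
split=> [cA a b Aa ab|cA a Aa v av]; first exact: cA Aa _ (desc_edge ab).
by elim/desc_ind: av Aa => // u w {}v uw _ IH Au; apply: IH; apply: cA uw.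
Qed.

Lemma desc_closed_desc a : desc_closed (desc a).
Proof. by move=> u au v; apply: desc_trans. Qed.

Lemma fin_gen_closed A : fin_gen A -> desc_closed A.
Proof.
move=> [k [g Ag]] a /Ag[i gia] v av; apply/Ag; exists i.
exact: desc_trans av.
Qed.

(** Generators may be indexed by any finite type and filtered by an arbitrary predicate, which
    classical reflection turns into a finite subtype. *)
Lemma fin_gen_fin (F : finType) (C : F -> Prop) (g : F -> G) :
  fin_gen (fun v => exists2 i, C i & desc (g i) v).
Proof.
pose F' := {i : F | `[< C i >]}.
exists #|{: F'}|, (fun i => g (val (enum_val i))) => v; split.
  move=> [i /asboolP Ci giv].
  by exists (enum_rank (exist _ i Ci : F')); rewrite enum_rankK.
move=> [i giv]; exists (val (enum_val i)) => //.
by apply/asboolP; apply: (valP (enum_val i)).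
Qed.

Lemma fin_gen_desc a : fin_gen (desc a).
Proof. by exists 1, (fun=> a) => v; split=> [|[]] //; exists ord0. Qed.

Lemma fin_genU A P : fin_gen A -> fin_gen P -> fin_gen (fun v => A v \/ P v).
Proof.
move=> [k [g Ag]] [l [h Ph]].
have := fin_gen_fin (fun=> True)
  (fun i : 'I_k + 'I_l => match i with inl i => g i | inr j => h j end).
congr fin_gen; apply: funext => v; apply/propext; split.
  by move=> [[i|j] _ ?]; [left; apply/Ag; exists i|right; apply/Ph; exists j].
by move=> [/Ag[i ?]|/Ph[j ?]]; [exists (inl i)|exists (inr j)].
Qed.

(** Allows attaching one tree [desc x] at a time. The induction runs over lists of generator
    indices, every partial union being finitely generated again. *)
Lemma fin_gen_ind (Phi : (G -> Prop) -> Prop) :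
  Phi (fun=> False) ->
  (forall P x, fin_gen P -> Phi P -> Phi (fun v => P v \/ desc x v)) ->
  forall P, fin_gen P -> Phi P.
Proof.
move=> Phi0 PhiS P [k [g Pg]].
suff H (s : seq 'I_k) : fin_gen (fun v => exists2 i, i \in s & desc (g i) v) /\
    Phi (fun v => exists2 i, i \in s & desc (g i) v).
  have [_] := H (enum 'I_k); congr Phi; apply: funext => v; apply/propext.
  rewrite Pg; split=> [[i _ ?]|[i ?]]; first by exists i.
  by exists i; rewrite ?mem_enum.
split; first exact: fin_gen_fin.
elim: s => [|j s IH].
  by move: Phi0; congr Phi; apply: funext => v; apply/propext; split=> // -[].
have := PhiS _ (g j) (fin_gen_fin (fun i => i \in s) g) IH.
congr Phi; apply: funext => v; apply/propext; split.
  move=> [[i si ?]|?]; first by exists i; rewrite // in_cons si orbT.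
  by exists j; rewrite ?mem_head.
by move=> [i /predU1P[->|si] ?]; [right|left; exists i].
Qed.

End Reachability.

(** * Induced subdigraphs and partial isomorphisms *)

Lemma sub_val_inj (G : digraph) (A : G -> Prop) :
  injective (fun x : sub A => proj1_sig x).
Proof. by move=> [x Ax] [y Ay] /= exy; apply: eq_exist. Qed.

Lemma desc_sub (G : digraph) (A : G -> Prop) (x y : sub A) :
  desc_closed A -> desc x y <-> desc (proj1_sig x) (proj1_sig y).
Proof.
move=> cA; split.
  by elim/desc_ind=> [u|u w v uw _ IH]; [exact: desc_refl|exact: desc_step IH].
case: x y => x Ax [y Ay] /= xy.
elim/desc_ind: xy Ax Ay => [u Au Au'|u w v uw _ IH Au Av].
  by rewrite (Prop_irrelevance Au Au'); apply: desc_refl.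
have Aw : A w by apply: cA Au _ (desc_edge uw).
by apply: desc_step (IH Aw Av).
Qed.

(* An isomorphism between descendant-closed subdigraphs, given by its graph. *)
Record piso (G H : digraph) (R : G -> H -> Prop) : Prop := Piso {
  piso_fun : forall x y y', R x y -> R x y' -> y = y';
  piso_inj : forall x x' y, R x y -> R x' y -> x = x';
  piso_edge : forall x y x' y', R x y -> R x' y' -> edge x x' <-> edge y y';
  piso_dom : forall x y x', R x y -> edge x x' -> exists y', R x' y';
  piso_cod : forall x y y', R x y -> edge y y' -> exists x', R x' y' }.

Definition dom (G H : Type) (R : G -> H -> Prop) (x : G) := exists y, R x y.
Definition cod (G H : Type) (R : G -> H -> Prop) (y : H) := exists x, R x y.

Lemma piso_inv (G H : digraph) (R : G -> H -> Prop) :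
  piso R -> piso (fun y x => R x y).
Proof.
case=> f i e d c; split=> //.
- by move=> y x x'; apply: i.
- by move=> y y' x; apply: f.
- by move=> y x y' x' xy xy'; apply: iff_sym; apply: e.
- by move=> y x y'; apply: c.
- by move=> y x x'; apply: d.
Qed.

Lemma piso_comp (G H K : digraph) (R : G -> H -> Prop) (S : H -> K -> Prop) :
  piso R -> piso S -> (forall y, cod R y -> dom S y) ->
  piso (fun x z => exists2 y, R x y & S y z).
Proof.
move=> pR pS cRS; split.
- move=> x z z' [y xy yz] [y' xy' yz'].
  by rewrite -(piso_fun pR xy xy') in yz'; apply: (piso_fun pS yz yz').
- move=> x x' z [y xy yz] [y' xy' yz'].
  by rewrite -(piso_inj pS yz yz') in xy'; apply: (piso_inj pR xy xy').
- move=> x z x' z' [y xy yz] [y' xy' yz'].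
  exact: iff_trans (piso_edge pR xy xy') (piso_edge pS yz yz').
- move=> x z x' [y xy yz] xx'; have [y' xy'] := piso_dom pR xy xx'.
  have [|z' yz'] := cRS y'; first by exists x'.
  by exists z', y'.
- move=> x z z' [y xy yz] zz'; have [y' yz'] := piso_cod pS yz zz'.
  have [x' xy'] := piso_cod pR xy ((piso_edge pS yz yz').2 zz').
  by exists x', y'.
Qed.

Lemma piso_desc (G H : digraph) (R : G -> H -> Prop) x y x' :
  piso R -> R x y -> desc x x' -> exists2 y', R x' y' & desc y y'.
Proof.
move=> pR xy xx'; elim/desc_ind: xx' y xy => [u y uy|u w v uw _ IH y uy].
  by exists y => //; apply: desc_refl.
have [z wz] := piso_dom pR uy uw; have [y' vy' zy'] := IH _ wz.
by exists y' => //; apply: desc_step zy'; apply/(piso_edge pR uy wz).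
Qed.

Lemma piso_dom_closed (G H : digraph) (R : G -> H -> Prop) :
  piso R -> desc_closed (dom R).
Proof.
by move=> pR; apply/desc_closedP => a b [y Ray]; apply: piso_dom Ray.
Qed.

Lemma piso_cod_closed (G H : digraph) (R : G -> H -> Prop) :
  piso R -> desc_closed (cod R).
Proof. by move=> pR; apply: (piso_dom_closed (piso_inv pR)). Qed.

Lemma piso_fin_gen (G H : digraph) (R : G -> H -> Prop) :
  piso R -> fin_gen (dom R) -> fin_gen (cod R).
Proof.
move=> pR [k [g Rg]].
have Rgi i : dom R (g i) by apply/Rg; exists i; apply: desc_refl.
have [h Rh] := choice Rgi.
exists k, h => v; split.
  move=> [x xv]; have [|i gix] := (Rg x).1; first by exists v.
  have [y xy hy] := piso_desc pR (Rh i) gix.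
  by exists i; rewrite (piso_fun pR xv xy).
by move=> [i /(piso_desc (piso_inv pR) (Rh i))[x]]; exists x.
Qed.

Lemma rel_iso (G H : digraph) (R : G -> H -> Prop) :
  piso R -> (forall x, dom R x) -> (forall y, cod R y) ->
  exists2 f : G -> H, is_iso f & forall x, R x (f x).
Proof.
move=> pR /choice[f Rf] /choice[g Rg]; exists f => //; exists g; split.
  by move=> x; apply: (piso_inj pR (Rg (f x)) (Rf x)).
split; first by move=> y; apply: (piso_fun pR (Rf (g y)) (Rg y)).
by move=> x y; apply: iff_sym; apply: (piso_edge pR (Rf x) (Rf y)).
Qed.

Lemma piso_restr (G H : digraph) (R : G -> H -> Prop) (A : G -> Prop) :
  piso R -> desc_closed A -> piso (fun x y => A x /\ R x y).
Proof.
move=> pR /desc_closedP cA; split.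
- by move=> x y y' [_ xy] [_]; apply: piso_fun xy.
- by move=> x x' y [_ xy] [_]; apply: piso_inj xy.
- by move=> x y x' y' [_ xy] [_]; apply: piso_edge xy.
- move=> x y x' [Ax xy] xx'; have [y' ?] := piso_dom pR xy xx'.
  by exists y'; split=> //; apply: cA xx'.
- move=> x y y' [Ax xy] yy'; have [x' xy'] := piso_cod pR xy yy'.
  by exists x'; split=> //; apply: (cA x) => //; apply/(piso_edge pR xy xy').
Qed.

Lemma piso_sub (G : digraph) (A : G -> Prop) :
  desc_closed A -> piso (fun (x : sub A) y => proj1_sig x = y).
Proof.
move=> /desc_closedP cA; split.
- by move=> x y y' <- <-.
- by move=> x x' y <- xx'; apply: sub_val_inj.
- by move=> x y x' y' <- <-.
- by move=> x y x' _ _; exists (proj1_sig x').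
- by move=> x y y' <- xy; exists (exist _ y' (cA _ _ (proj2_sig x) xy)).
Qed.

Lemma is_iso_piso (G H : digraph) (f : G -> H) :
  is_iso f -> piso (fun x y => f x = y).
Proof.
move=> [g [fK [gK fe]]]; split.
- by move=> x y y' <- <-.
- by move=> x x' y <- /(can_inj fK).
- by move=> x y x' y' <- <-; apply: iff_sym.
- by move=> x y x' _ _; exists (f x').
- by move=> x y y' _ _; exists (g y').
Qed.

Lemma piso_sub_iso (G H : digraph) (R : G -> H -> Prop) :
  piso R -> exists2 f : sub (dom R) -> sub (cod R), is_iso f &
    forall x, R (proj1_sig x) (proj1_sig (f x)).
Proof.
move=> pR.
pose S (x : sub (dom R)) (y : sub (cod R)) := R (proj1_sig x) (proj1_sig y).
have pS : piso S.
  split=> [x y y'|x x' y|x y x' y'|x y [x' [y' xy']] _ _|x y [y' [x' xy']] _ _].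
  - by move=> xy xy'; apply/sub_val_inj/(piso_fun pR xy xy').
  - by move=> xy xy'; apply/sub_val_inj/(piso_inj pR xy xy').
  - exact: (piso_edge pR).
  - by exists (exist _ y' (ex_intro _ x' xy')).
  - by exists (exist _ x' (ex_intro _ y' xy')).
apply: (rel_iso pS) => -[x [y xy]].
  by exists (exist _ y (ex_intro _ x xy)).
by exists (exist _ y (ex_intro _ x xy)).
Qed.

(** Homogeneity for isomorphisms given as relations, so that partial maps can be composed,
    restricted and glued without subtypes. *)
Lemma homogeneous_extend (D : digraph) (R : D -> D -> Prop) :
  desc_homogeneous D -> piso R -> fin_gen (dom R) ->
  exists2 s : D -> D, is_iso s & forall x y, R x y -> s x = y.
Proof.
move=> hD pR fR; have [f fiso Rf] := piso_sub_iso pR.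
have [s [siso sf]] := hD _ _ (piso_dom_closed pR) fR (piso_cod_closed pR)
  (piso_fin_gen pR fR) f fiso.
exists s => // x y xy.
pose x' : sub (dom R) := exist _ x (ex_intro _ y xy).
by have /= -> := sf x'; apply: (piso_fun pR (Rf x') xy).
Qed.

(** * Back-and-forth *)

Definition fg_embeds (D E : digraph) : Prop :=
  forall A : D -> Prop, desc_closed A -> fin_gen A ->
  exists2 B : E -> Prop, desc_closed B /\ fin_gen B & iso (sub B) (sub A).

Definition fg_piso (D E : digraph) (R : D -> E -> Prop) : Prop :=
  piso R /\ fin_gen (dom R).

Lemma fg_piso_inv (D E : digraph) (R : D -> E -> Prop) :
  fg_piso R -> fg_piso (fun y x => R x y).
Proof. by move=> [pR fR]; split; [exact: piso_inv|exact: piso_fin_gen]. Qed.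

(** A copy [R1] of the enlarged domain in [E] need not agree with [R]. The disagreement [S] is a
    partial isomorphism of [E], from the [R1]-image of [dom R] onto the [R]-image; an automorphism
    [s] extending it corrects [R1]. *)
Lemma fg_piso_extend (D E : digraph) (R : D -> E -> Prop) (d : D) :
  fg_embeds D E -> desc_homogeneous E -> fg_piso R ->
  exists R', [/\ fg_piso R', forall x y, R x y -> R' x y & dom R' d].
Proof.
move=> DE hE [pR fR].
pose A x := dom R x \/ desc d x.
have fA : fin_gen A by apply: fin_genU => //; apply: fin_gen_desc.
have cA := fin_gen_closed fA.
have [B [cB fB] [f fiso]] := DE A cA fA.
pose R1 x y := exists2 z : sub B, proj1_sig z = y & proj1_sig (f z) = x.
have pR1 : piso R1.
  have p1 : piso (fun x z => exists2 t : sub A, proj1_sig t = x & f z = t).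
    apply: (piso_comp (piso_inv (piso_sub cA)) (piso_inv (is_iso_piso fiso))).
    by move=> z _; have [g [_ [fg _]]] := fiso; exists (g z); rewrite fg.
  have := piso_comp p1 (piso_sub cB).
  move/(_ (fun z _ => ex_intro _ (proj1_sig z) erefl)).
  congr piso; apply: funext => x; apply: funext => y; apply/propext; split.
    by move=> [z [t tx ftz] zy]; exists z; rewrite // ftz.
  by move=> [z zy fzx]; exists z => //; exists (f z).
have dR1 : dom R1 = A.
  apply: funext => x; apply/propext; split=> [[y [z _ <-]]|Ax].
    exact: proj2_sig.
  have [g [_ [fg _]]] := fiso.
  by exists (proj1_sig (g (exist _ x Ax))), (g (exist _ x Ax)); rewrite ?fg.
have pR1' := piso_restr pR1 (piso_dom_closed pR).
pose S y z := exists2 x, dom R x /\ R1 x y & R x z.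
have pS : piso S.
  apply: (piso_comp (piso_inv pR1') pR) => x [y []] //.
have fS : fin_gen (dom S).
  have := piso_fin_gen pR1'.
  have -> : dom (fun x y => dom R x /\ R1 x y) = dom R.
    apply: funext => x; apply/propext; split=> [[y []] //|Rx].
    have [y xy] : dom R1 x by rewrite dR1; left.
    by exists y.
  move/(_ fR); congr fin_gen; apply: funext => y; apply/propext; split.
    by move=> [x [[z xz] xy]]; exists z, x => //; split=> //; exists z.
  by move=> [z [x [Rx xy] xz]]; exists x.
have [s siso sS] := homogeneous_extend hE pS fS.
exists (fun x z => exists2 y, R1 x y & s y = z); split.
- have pR' : piso (fun x z => exists2 y, R1 x y & s y = z).
    by apply: (piso_comp pR1 (is_iso_piso siso)) => y _; exists (s y).
  split=> //; have := fA; rewrite -dR1; congr fin_gen.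
  apply: funext => x; apply/propext; split=> [[y xy]|[_ [y xy _]]].
    by exists (s y), y.
  by exists y.
- move=> x z xz; have [y xy] : dom R1 x by rewrite dR1; left; exists z.
  by exists y => //; apply: sS; exists x => //; split=> //; exists z.
- have [y dy] : dom R1 d by rewrite dR1; right; apply: desc_refl.
  by exists (s y), y.
Qed.

Lemma piso_empty (D E : digraph) : fg_piso (fun (_ : D) (_ : E) => False).
Proof.
split; first by split.
have g (i : 'I_0) : D by case: i.
by exists 0, g => v; split=> [[]|[[]]].
Qed.

Lemma back_and_forth (D E : digraph) :
  countable_digraph D -> countable_digraph E ->
  desc_homogeneous D -> desc_homogeneous E ->
  fg_embeds D E -> fg_embeds E D -> iso D E.
Proof.
move=> [cD injD] [cE injE] hD hE DE ED.
pose S := {R : D -> E -> Prop | fg_piso R}.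
(* A number that codes no vertex leaves the relation unchanged. *)
have extD (R : S) n : exists R' : S, (forall x y, sval R x y -> sval R' x y) /\
    forall d, cD d = n -> dom (sval R') d.
  have [[d dn]|nd] := pselect (exists d, cD d = n); last first.
    by exists R; split=> // d dn; case: nd; exists d.
  have [R' [fR' RR' R'd]] := fg_piso_extend d DE hE (svalP R).
  exists (exist _ R' fR'); split=> // d'; rewrite -dn.
  by move=> /injD ->.
have extE (R : S) n : exists R' : S, (forall x y, sval R x y -> sval R' x y) /\
    forall e, cE e = n -> cod (sval R') e.
  have [[e en]|ne] := pselect (exists e, cE e = n); last first.
    by exists R; split=> // e en; case: ne; exists e.
  have [R' [fR' RR' R'e]] := fg_piso_extend e ED hD (fg_piso_inv (svalP R)).
  exists (exist _ _ (fg_piso_inv fR')); split=> [x y|e'] /=; first exact: RR'.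
  by rewrite -en => /injE ->.
have ext (Rn : S * nat) : exists R' : S,
    [/\ forall x y, sval Rn.1 x y -> sval R' x y,
        forall d, cD d = Rn.2 -> dom (sval R') d &
        forall e, cE e = Rn.2 -> cod (sval R') e].
  case: Rn => R n /=; have [R1 [RR1 R1d]] := extD R n.
  have [R2 [R12 R2e]] := extE R1 n; exists R2; split=> //.
    by move=> x y /RR1/R12.
  by move=> d /R1d[y dy]; exists y; apply: R12.
have [step stepP] := choice ext.
pose R := fix R n : S :=
  if n is n'.+1 then step (R n', n') else exist _ _ (piso_empty D E).
have Rle m n : m <= n -> forall x y, sval (R m) x y -> sval (R n) x y.
  elim: n => [|n IH]; first by rewrite leqn0 => /eqP->.
  rewrite leq_eqVlt => /predU1P[->//|/IH mn x y /mn].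
  by have [RS _ _] := stepP (R n, n); apply: RS.
have pR n : piso (sval (R n)) by case: (R n) => ? [].
pose U x y := exists n, sval (R n) x y.
(* Any two pairs of the union occur together at some stage, so the axioms of [piso] pass to the
   union. *)
have lub x y x' y' : U x y -> U x' y' ->
    exists n, sval (R n) x y /\ sval (R n) x' y'.
  move=> [m xy] [n xy']; exists (maxn m n).
  by split; [apply: Rle xy|apply: Rle xy']; rewrite ?leq_maxl ?leq_maxr.
have pU : piso U.
  split.
  - by move=> x y y' /lub h /h[n [xy xy']]; apply: (piso_fun (pR n) xy xy').
  - by move=> x x' y /lub h /h[n [xy xy']]; apply: (piso_inj (pR n) xy xy').
  - by move=> x y x' y' /lub h /h[n [xy xy']]; apply: (piso_edge (pR n) xy xy').
  - move=> x y x' [n xy] /(piso_dom (pR n) xy)[y' xy'].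
    by exists y', n.
  - move=> x y y' [n xy] /(piso_cod (pR n) xy)[x' xy'].
    by exists x', n.
have [||f fiso _] := rel_iso pU; last by exists f.
- move=> d; have [_ /(_ d erefl)[e de] _] := stepP (R (cD d), cD d).
  by exists e, (cD d).+1.
- move=> e; have [_ _ /(_ e erefl)[d de]] := stepP (R (cE e), cE e).
  by exists d, (cE e).+1.
Qed.

(** * Words as coordinates on descendant trees *)

Section Charts.
Variable q : nat.
Implicit Type G : digraph.

(** An isomorphism from [Ttree q] onto [desc a] in word coordinates. The edge clause describes all
    out-neighbours in [G], which makes the image descendant-closed and hence equal to [desc a]. *)
Definition chart G (a : G) (psi : seq 'I_q -> G) : Prop :=
  [/\ psi [::] = a, injective psi &
      forall w v, edge (psi w) v <-> exists i, v = psi (rcons w i)].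

Lemma desc_image G (psi : seq 'I_q -> G) w v :
  (forall w v, edge (psi w) v <-> exists i, v = psi (rcons w i)) ->
  desc (psi w) v <-> exists u, v = psi (w ++ u).
Proof.
move=> psiE; split.
  move: {-1}(psi w) (erefl (psi w)) => x psiw xv.
  elim/desc_ind: xv w psiw => [u w <-|u y {}v uy _ IH w psiw].
    by exists [::]; rewrite cats0.
  move: uy; rewrite -psiw => /psiE[i yE]; have [t ->] := IH _ (esym yE).
  by exists (i :: t); rewrite cat_rcons.
move=> [u ->]; elim/last_ind: u => [|u i IH].
  by rewrite cats0; apply: desc_refl.
apply: desc_trans IH _; apply: desc_edge; apply/psiE; exists i.
by rewrite rcons_cat.
Qed.

Lemma chart_desc G (a : G) psi w v :
  chart a psi -> desc (psi w) v <-> exists u, v = psi (w ++ u).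
Proof. by move=> [_ _ psiE]; apply: desc_image. Qed.

Lemma chart_root G (a : G) psi v :
  chart a psi -> desc a v <-> exists u, v = psi u.
Proof. by move=> ca; have [<- _ _] := ca; apply: (chart_desc [::] v ca). Qed.

Lemma chart_sub G (a : G) psi w :
  chart a psi -> chart (psi w) (fun u => psi (w ++ u)).
Proof.
move=> [psi0 psiI psiE]; split; first by rewrite cats0.
  by move=> u v /= /psiI /eqP; rewrite eqseq_cat // eqxx => /eqP ->.
move=> u v; split=> [/psiE[i ->]|[i ->]]; first by exists i; rewrite rcons_cat.
by apply/psiE; exists i; rewrite rcons_cat.
Qed.

Lemma chartP G (a : G) :
  iso (sub (desc a)) (Ttree q) <-> exists psi, chart a psi.
Proof.
split=> [[f [g [fK [gK fE]]]]|[psi ca]].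
  pose psi w := proj1_sig (g w : sub (desc a)); exists psi.
  have psiI : injective psi by move=> w w' /sub_val_inj /(can_inj gK).
  have psiE w v : edge (psi w) v <-> exists i, v = psi (rcons w i).
    split=> [wv|[i ->]].
      have av : desc a v.
        exact: desc_trans (proj2_sig (g w)) (desc_edge wv).
      have [] := (fE (g w) (exist _ v av)).2 wv => i; rewrite gK => fv.
      by exists i; rewrite /psi -fv fK.
    by apply: (fE (g w) (g (rcons w i))).1; rewrite !gK; exists i.
  (* The root goes to the root: [a] reaches [psi [::]], so [[::]] extends the word labelling [a],
     which is therefore empty. *)
  split=> //; pose a' : sub (desc a) := exist _ a (desc_refl a).
  have aE : psi (f a') = a by rewrite /psi fK.
  have : desc a (psi [::]) by apply: (proj2_sig (g [::])).
  rewrite -{1}aE => /(desc_image _ _ psiE)[u /psiI].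
  by case: (f a') aE.
have [psi0 psiI psiE] := ca.
have := @rel_iso (sub (desc a)) (Ttree q) (fun x w => proj1_sig x = psi w).
case.
- split.
  + by move=> x w w' /= -> /psiI.
  + by move=> x x' w <- xx'; apply: sub_val_inj.
  + move=> x w x' w' xE xE'; rewrite -[edge x x']/(edge (sval x) (sval x')).
    rewrite xE xE' psiE.
    by split=> -[i]; [move=> /psiI|move=> ->]; exists i.
  + move=> x w x' xE; rewrite -[edge x x']/(edge (sval x) (sval x')).
    rewrite xE => /psiE[i ->].
    by exists (rcons w i).
  + move=> x w w' xE [i ->].
    have aw : desc a (psi (rcons w i)) by apply/(chart_root _ ca); exists (rcons w i).
    by exists (exist _ _ aw).
- by move=> x; have /(chart_root _ ca)[u xu] := proj2_sig x; exists u.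
- move=> w; have aw : desc a (psi w) by apply/(chart_root _ ca); exists w.
  by exists (exist _ _ aw).
by move=> f fiso _; exists f.
Qed.

(** [N] bounds the lengths of the words labelling generators; conversely the words of length at most
    [N] with label in [P] are finitely many and generate. *)
Lemma chart_fin_gen G (a : G) psi (P : G -> Prop) :
  chart a psi -> desc_closed P ->
  fin_gen (fun v => desc a v /\ P v) <->
  exists N, forall w, P (psi w) -> P (psi (take N w)).
Proof.
move=> ca cP; have [psi0 psiI psiE] := ca; split.
  move=> [k [g Pg]].
  have gi i : exists w, g i = psi w /\ P (psi w).
    have [|/(chart_root _ ca)[w ->] Pw] := (Pg (g i)).2; last by exists w.
    by exists i; apply: desc_refl.
  have [h gh] := choice gi.
  exists (\max_i size (h i)) => w Pw.
  have [|i] := (Pg (psi w)).1.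
    by split=> //; apply/(chart_root _ ca); exists w.
  have [-> Ph] := gh i; move=> /(chart_desc _ _ ca)[u /psiI ->].
  apply: cP Ph _ _; apply/(chart_desc _ _ ca).
  rewrite take_cat; case: ltnP => [|_]; last by eexists.
  by rewrite ltnNge leq_bigmax.
move=> [N PN].
have := fin_gen_fin (fun w : {bseq N of 'I_q} => P (psi w)) (fun w => psi w).
congr fin_gen; apply: funext => v; apply/propext; split.
  move=> [w Pw wv]; split; last exact: cP wv.
  by apply: desc_trans wv; apply/(chart_root _ ca); eexists.
move=> [/(chart_root _ ca)[w ->] /PN Pw].
have sw : size (take N w) <= N by rewrite size_take_min geq_minl.
exists (Bseq sw) => //=; apply/(chart_desc _ _ ca); exists (drop N w).
by rewrite cat_take_drop.
Qed.

Definition charted G := forall a : G, exists psi, chart a psi.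
Definition meets_fg G := forall a b : G, fin_gen (fun v => desc a v /\ desc b v).

(** Each generator of [P] has a depth bound. As the sets are descendant-closed, a larger depth also
    works, so the maximum serves for the union. *)
Lemma fin_gen_meet G (a : G) psi (P : G -> Prop) :
  meets_fg G -> chart a psi -> fin_gen P ->
  exists N, forall w, P (psi w) -> P (psi (take N w)).
Proof.
move=> mG ca; elim/fin_gen_ind=> [|{}P x fP [N PN]]; first by exists 0.
have cP := fin_gen_closed fP; have cx := @desc_closed_desc _ x.
have [M xM] := (chart_fin_gen ca cx).1 (mG a x).
have mono (Q : G -> Prop) m n w : desc_closed Q -> m <= n ->
    Q (psi (take m w)) -> Q (psi (take n w)).
  move=> cQ mn Qm; apply: cQ Qm _ _; apply/(chart_desc _ _ ca).
  by exists (drop m (take n w)); rewrite -(take_takel w mn) cat_take_drop.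
exists (maxn N M) => w [/PN Pw|/xM xw]; [left|right].
  by apply: mono Pw => //; rewrite leq_maxl.
by apply: mono xw => //; rewrite leq_maxr.
Qed.

End Charts.

(** * Tree automorphisms and diagonalisation *)

Section TreeAutomorphisms.
Variable q : nat.
Implicit Types (w u p v x : seq 'I_q) (S U : seq 'I_q -> Prop).

(* Only automorphisms whose local permutations [pi w] are involutions: swapping
   two children is all that the diagonal argument needs. *)
Definition tree_aut (s : seq 'I_q -> seq 'I_q) : Prop :=
  exists2 pi : seq 'I_q -> 'I_q -> 'I_q, forall w, involutive (pi w) &
    s [::] = [::] /\ forall w i, s (rcons w i) = rcons (s w) (pi w i).

Lemma tree_aut_size s w : tree_aut s -> size (s w) = size w.
Proof.
by move=> [pi _ [s0 sS]]; elim/last_ind: w => [|w i IH];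
  rewrite ?s0 // sS !size_rcons IH.
Qed.

Lemma tree_aut_take s n w : tree_aut s -> s (take n w) = take n (s w).
Proof.
move=> sA; have [pi _ [s0 sS]] := sA.
elim/last_ind: w => [|w i IH]; first by rewrite s0.
have [nw|wn] := leqP n (size w).
  by rewrite sS -!cats1 !takel_cat // tree_aut_size.
by rewrite !take_oversize // ?tree_aut_size ?size_rcons.
Qed.

Lemma tree_aut_cat s w u :
  tree_aut s -> s (w ++ u) = s w ++ drop (size w) (s (w ++ u)).
Proof.
move=> sA; rewrite -{2}(take_size_cat u (erefl (size w))).
by rewrite tree_aut_take // cat_take_drop.
Qed.

Lemma tree_aut_surj s w u :
  tree_aut s -> exists u', s (w ++ u') = s w ++ u.
Proof.
move=> [pi piK [s0 sS]]; elim/last_ind: u => [|u i [u' IH]].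
  by exists [::]; rewrite !cats0.
exists (rcons u' (pi (w ++ u') i)).
by rewrite -!rcons_cat sS IH piK.
Qed.

Lemma tree_aut_inj s : tree_aut s -> injective s.
Proof.
move=> sA w w' sww'; have sz : size w = size w'.
  by rewrite -(tree_aut_size w sA) sww' tree_aut_size.
have [pi piK [s0 sS]] := sA.
elim/last_ind: w w' sz sww' => [|w i IH] w'; first by case: w'.
case/lastP: w' => [|w' k]; first by rewrite size_rcons.
rewrite !size_rcons !sS => -[sz] /rcons_inj[/IH-> // pii].
by congr rcons; apply: inv_inj pii; apply: piK.
Qed.

Lemma take_cat_size w u n : w ++ take n u = take (size w + n) (w ++ u).
Proof. by rewrite take_cat ltnNge leq_addr /= addKn. Qed.

(* For [S] closed under extension of words: its part below [w] is not finitely generated. *)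
Definition big S w : Prop :=
  forall N, exists u, S (w ++ u) /\ ~ S (w ++ take N u).

(** An automorphism preserves lengths and commutes with truncation, so a depth bound below [w]
    transfers to [s w] and back. *)
Lemma tree_aut_big s S U w :
  tree_aut s -> (forall x, U (s x) <-> S x) -> big S w <-> big U (s w).
Proof.
move=> sA sU.
have key u N : s w ++ take N (drop (size w) (s (w ++ u))) = s (w ++ take N u).
  rewrite take_cat_size -tree_aut_cat // tree_aut_size //.
  by rewrite -tree_aut_take // take_cat_size.
split=> bw N.
  have [u [Su nSu]] := bw N; exists (drop (size w) (s (w ++ u))).
  by rewrite -tree_aut_cat // key !sU.
have [u [Uu nUu]] := bw N; have [u' u'E] := tree_aut_surj w u sA.
have uE : u = drop (size w) (s (w ++ u')).
  by rewrite u'E drop_size_cat // tree_aut_size.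
exists u'; rewrite -!sU u'E; split=> //.
by rewrite -key -uE.
Qed.

Section Splitting.
Variable S : seq 'I_q -> Prop.
Hypothesis cS : forall w u, S w -> S (w ++ u).

(** If every child had a depth bound, then one more than the maximum of these finitely many bounds
    would serve for [w]. *)
Lemma big_child w : big S w -> exists i, big S (rcons w i).
Proof.
move=> bw; apply: contrapT => nb.
have Ni i : exists N, forall u, S (rcons w i ++ u) -> S (rcons w i ++ take N u).
  apply: contrapT => nN; apply: nb; exists i => N; apply: contrapT => nu.
  apply: nN; exists N => u Su; apply: contrapT => nSu.
  by apply: nu; exists u.
have [N NP] := choice Ni.
have [[|i u] [Su]] := bw (\max_i N i).+1; first by case.
case=> /=; rewrite -cat_rcons in Su; have := NP _ _ Su.
have le := leq_bigmax i (F := N).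
move/(cS (drop (N i) (take (\max_i N i) u))).
by rewrite -catA -(take_takel u le) cat_take_drop cat_rcons.
Qed.

(** The order matters: the first child is the one that is not big. [None] means that no such pair of
    children exists. *)
Definition splitting p : option ('I_q * 'I_q) :=
  [pick ij | `[< ~ big S (rcons p ij.1) /\ big S (rcons p ij.2) >]].

(** Only proper prefixes are counted. The value at a splitting node says which requirement is
    treated there. *)
Definition nsplit p : nat := \sum_(k < size p) isSome (splitting (take k p)).

Lemma nsplit_rcons p i : nsplit (rcons p i) = nsplit p + isSome (splitting p).
Proof.
rewrite /nsplit size_rcons big_ord_recr /= -cats1 take_size_cat //.
congr (_ + _); apply: eq_bigr => k _.
by rewrite takel_cat // ltnW.
Qed.

(** Follow a path from [w] into [S]. At a big node that does not split all children are big, since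
    one is; but a word of [S] is not big, so the path meets a splitting node. At the first one the
    count is still that of [w]. *)
Lemma splitting_exists w :
  big S w -> exists2 p, isSome (splitting p) & nsplit p = nsplit w.
Proof.
move=> bw; have [u [Su _]] := bw 0.
elim: u w bw Su => [|i u IH] w bw Su.
  by have [u [_]] := bw 0; rewrite take0.
case spw: (isSome (splitting w)); first by exists w.
have bi : big S (rcons w i).
  have [j bj] := big_child bw; apply: contrapT => nbi.
  move: spw; rewrite /splitting; case: pickP => //= /(_ (i, j)).
  by move/asboolP; case.
have [||p sp np] := IH (rcons w i); rewrite ?cat_rcons //.
by exists p; rewrite // np nsplit_rcons spw addn0.
Qed.

(** Passing from a splitting node to its big child raises the count by one and keeps bigness. *)
Lemma nsplit_surj n : big S [::] -> exists2 w, big S w & nsplit w = n.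
Proof.
move=> b0; elim: n => [|n [w bw wn]].
  by exists [::]; rewrite // /nsplit big_ord0.
have [p sp pn] := splitting_exists bw.
move: (sp); rewrite {1}/splitting; case: pickP => //= -[i j] /asboolP[_ bj] _.
by exists (rcons p j); rewrite // nsplit_rcons sp pn wn addn1.
Qed.

(* Diagonalisation: at a splitting node of index [n] the automorphism sends a
   big child or a non-big one to the same place, whichever contradicts [U n]. *)
Lemma tree_aut_diagonal (U : nat -> seq 'I_q -> Prop) :
  big S [::] ->
  exists2 s, tree_aut s & forall n, ~ forall w, U n (s w) <-> S w.
Proof.
move=> b0.
pose pi p v : 'I_q -> 'I_q := if splitting p is Some (i, j) then
  if `[< big (U (nsplit p)) (rcons v i) >] then id else tperm i j else id.
have piK p v : involutive (pi p v).
  move=> i; rewrite /pi; case: splitting => [[k l]|] //.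
  by case: asbool => //; apply: tpermK.
(* The permutation at a node depends on the image [v] of that node, so the fold carries the word
   read so far together with its image. *)
pose st w := foldl
  (fun pv i => (rcons pv.1 i, rcons pv.2 (pi pv.1 pv.2 i))) ([::], [::]) w.
pose s w := (st w).2.
have stS w i : st (rcons w i) = (rcons (st w).1 i, rcons (s w) (pi (st w).1 (s w) i)).
  by rewrite {1}/st -cats1 foldl_cat.
have st1 w : (st w).1 = w by elim/last_ind: w => [|w i IH] //; rewrite stS IH.
have sS w i : s (rcons w i) = rcons (s w) (pi w (s w) i).
  by rewrite {1}/s stS st1.
have sA : tree_aut s by exists (fun w => pi w (s w)).
exists s => // n UnS.
have [w bw wn] := nsplit_surj n b0.
have [p sp pn] := splitting_exists bw.
case spE: (splitting p) sp => [[i j]|] //= _.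
have [nbi bj] : ~ big S (rcons p i) /\ big S (rcons p j).
  by move: spE; rewrite /splitting; case: pickP => //= -[k l] /asboolP ? [<- <-].
have sbig x := tree_aut_big x sA UnS.
have [bU|nbU] := pselect (big (U n) (rcons (s p) i)).
  apply: nbi; apply/sbig; rewrite sS /pi spE pn wn.
  by case: asboolP.
move/sbig: bj; rewrite sS /pi spE pn wn.
by case: asboolP => // _; rewrite tpermR.
Qed.

End Splitting.
End TreeAutomorphisms.

(** * Finite generation of intersections of descendant sets *)

Lemma tree_aut_piso q (G : digraph) (a : G) psi (s : seq 'I_q -> seq 'I_q) :
  chart a psi -> tree_aut s ->
  piso (fun x y => exists w, x = psi w /\ y = psi (s w)).
Proof.
move=> [_ psiI psiE] sA; have sI := tree_aut_inj sA.
have [pi piK [s0 sS]] := sA; split.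
- by move=> x y y' [w [-> ->]] [w' [/psiI-> ->]].
- by move=> x x' y [w [-> ->]] [w' [-> /psiI/sI->]].
- move=> x y x' y' [w [-> ->]] [w' [-> ->]]; rewrite !psiE.
  split=> -[i /psiI].
    by move=> ->; exists (pi w i); rewrite sS.
  move=> sw'; exists (pi w i); congr psi; apply: sI.
  by rewrite sS piK.
- move=> x y x' [w [-> _]] /psiE[i ->].
  by exists (psi (s (rcons w i))), (rcons w i).
- move=> x y y' [w [_ ->]] /psiE[i ->].
  by exists (psi (rcons w (pi w i))), (rcons w (pi w i)); rewrite sS piK.
Qed.

Lemma is_iso_desc (G H : digraph) (f : G -> H) x y :
  is_iso f -> desc (f x) (f y) <-> desc x y.
Proof.
move=> fiso; have pf := is_iso_piso fiso; have [g [fK _]] := fiso.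
split=> [fxy|xy].
  by have [y' /(can_inj fK)->] := piso_desc (piso_inv pf) (erefl (f x)) fxy.
by have [_ <-] := piso_desc pf (erefl (f x)) xy.
Qed.

Lemma homogeneous_meets_fg q (D : digraph) :
  countable_digraph D -> desc_homogeneous D -> charted q D -> meets_fg D.
Proof.
move=> [c cI] hD chD a b; have [psi ca] := chD a.
have [psi0 psiI psiE] := ca.
apply/(chart_fin_gen ca (@desc_closed_desc _ b)); apply: contrapT => nN.
pose S w := desc b (psi w).
have cS w u : S w -> S (w ++ u).
  by move=> Sw; apply: desc_trans Sw _; apply/(chart_desc _ _ ca); exists u.
have b0 : big S [::].
  move=> N; apply: contrapT => nu; apply: nN; exists N => w Sw.
  by apply: contrapT => nSw; apply: nu; exists w.
(* The trace on [desc a] of the descendant set of the vertex coded by [n], empty if there is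
   none. *)
pose U n w := exists2 d, c d = n & desc d (psi w).
have [s sA sU] := tree_aut_diagonal cS U b0.
have pR := tree_aut_piso ca sA.
have [|f fiso fR] := homogeneous_extend hD pR.
  have := fin_gen_desc a; congr fin_gen; apply: funext => v; apply/propext.
  rewrite (chart_root _ ca); split=> [[w ->]|[y [w [-> _]]]].
    by exists (psi (s w)), w.
  by exists w.
(* The extension [f] carries [desc b] to [desc (f b)], so the requirement indexed by the code of
   [f b] is violated. *)
apply: (sU (c (f b))) => w.
have fw : f (psi w) = psi (s w) by apply: fR; exists w.
rewrite /S -(is_iso_desc _ _ fiso) fw; split=> [[d /cI->] //|].
by exists (f b).
Qed.

(** * Gluing, and trees disjoint from a finitely generated set *)

Lemma piso_union (G H : digraph) (R S : G -> H -> Prop) :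
  piso R -> piso S -> (forall x, dom R x -> ~ dom S x) ->
  (forall y, cod R y -> ~ cod S y) -> piso (fun x y => R x y \/ S x y).
Proof.
move=> pR pS dRS cRS.
have dRS' x y y' : R x y -> S x y' -> False.
  by move=> Rx Sx; apply: (dRS x); [exists y|exists y'].
have cRS' x x' y : R x y -> S x' y -> False.
  by move=> Rx Sx; apply: (cRS y); [exists x|exists x'].
split.
- move=> x y y' [xy|xy] [xy'|xy'].
  + exact: (piso_fun pR xy xy').
  + by case: (dRS' _ _ _ xy xy').
  + by case: (dRS' _ _ _ xy' xy).
  + exact: (piso_fun pS xy xy').
- move=> x x' y [xy|xy] [xy'|xy'].
  + exact: (piso_inj pR xy xy').
  + by case: (cRS' _ _ _ xy xy').
  + by case: (cRS' _ _ _ xy' xy).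
  + exact: (piso_inj pS xy xy').
- move=> x y x' y' [xy|xy] [xy'|xy'].
  + exact: (piso_edge pR xy xy').
  (* Domains and codomains are descendant-closed, so by disjointness no edge joins the two pieces on
     either side. *)
  + split=> e; first by have [z xz] := piso_dom pR xy e; case: (dRS' _ _ _ xz xy').
    by have [z zy] := piso_cod pR xy e; case: (cRS' _ _ _ zy xy').
  + split=> e; first by have [z xz] := piso_dom pS xy e; case: (dRS' _ _ _ xy' xz).
    by have [z zy] := piso_cod pS xy e; case: (cRS' _ _ _ xy' zy).
  + exact: (piso_edge pS xy xy').
- move=> x y x' [xy|xy] e.
  + by have [y' ?] := piso_dom pR xy e; exists y'; left.
  + by have [y' ?] := piso_dom pS xy e; exists y'; right.
- move=> x y y' [xy|xy] e.
  + by have [x' ?] := piso_cod pR xy e; exists x'; left.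
  + by have [x' ?] := piso_cod pS xy e; exists x'; right.
Qed.

Lemma chart_piso q (G H : digraph) (a : G) (b : H) (phi : seq 'I_q -> G)
    (psi : seq 'I_q -> H) :
  chart a phi -> chart b psi ->
  piso (fun x y => exists w, x = phi w /\ y = psi w).
Proof.
move=> [_ phiI phiE] [_ psiI psiE]; split.
- by move=> x y y' [w [-> ->]] [w' [/phiI-> ->]].
- by move=> x x' y [w [-> ->]] [w' [-> /psiI->]].
- move=> x y x' y' [w [-> ->]] [w' [-> ->]]; rewrite phiE psiE.
  by split=> -[i]; [move=> /phiI->|move=> /psiI->]; exists i.
- by move=> x y x' [w [-> _]] /phiE[i ->]; exists (psi (rcons w i)), (rcons w i).
- by move=> x y y' [w [_ ->]] /psiE[i ->]; exists (phi (rcons w i)), (rcons w i).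
Qed.

(** Both words are the prefix, of their common length, of the word labelling [v]. *)
Lemma chart_desc_eq q (G : digraph) (a : G) (psi : seq 'I_q -> G) w w' v :
  chart a psi -> size w = size w' -> desc (psi w) v -> desc (psi w') v -> w = w'.
Proof.
move=> ca sz /(chart_desc _ _ ca)[u ->] /(chart_desc _ _ ca)[u'].
have [_ psiI _] := ca; move=> /psiI/eqP; rewrite eqseq_cat //.
by move=> /andP[/eqP].
Qed.

Section DisjointVertex.
Variables (q : nat) (D : digraph).
Hypotheses (q_gt1 : 1 < q) (hD : desc_homogeneous D) (chD : charted q D).
Hypothesis mD : meets_fg D.

Let i0 : 'I_q := Ordinal (ltnW q_gt1).
Let i1 : 'I_q := Ordinal q_gt1.

(** Puts [p] and most of [desc x] below the single vertex [s p]. Beyond the depth [N], a vertex of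
    [desc x] outside [desc p] has no descendant in [desc p]; hence the part taken from [desc x] is
    closed, disjoint from [desc p], and generated at depth [N], and the two pieces glue. *)
Lemma join_aut (p x : D) (phi psi : seq 'I_q -> D) :
  chart p phi -> chart x psi ->
  exists N, exists2 s : D -> D, is_iso s &
    (forall u, s (phi (i0 :: u)) = phi u) /\
    forall u, N <= size u -> ~ desc p (psi u) -> s (phi (i1 :: u)) = psi u.
Proof.
move=> cp cx; have [_ phiI phiE] := cp; have [_ psiI psiE] := cx.
have [N xN] := (chart_fin_gen cx (@desc_closed_desc _ p)).1 (mD x p).
have down u i : N <= size u -> ~ desc p (psi u) -> ~ desc p (psi (rcons u i)).
  move=> Nu npu /xN; rewrite -cats1 takel_cat // => pu; apply: npu.
  apply: desc_trans pu _; apply/(chart_desc _ _ cx); exists (drop N u).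
  by rewrite cat_take_drop.
pose C y := exists u, [/\ y = phi (i1 :: u), N <= size u & ~ desc p (psi u)].
have cC : desc_closed C.
  apply/desc_closedP => a b [u [-> Nu npu]] /phiE[i ->].
  exists (rcons u i); rewrite size_rcons; split=> //; first exact: leqW.
  exact: down.
have c0 : chart (phi [:: i0]) (fun u => phi (i0 :: u)) := chart_sub [:: i0] cp.
have c1 : chart (phi [:: i1]) (fun u => phi (i1 :: u)) := chart_sub [:: i1] cp.
have pS := piso_restr (chart_piso c1 cx) cC.
have pR := chart_piso c0 cp.
exists N.
have [| |s siso sR] := homogeneous_extend hD (R := fun y z =>
  (exists w, y = phi (i0 :: w) /\ z = phi w) \/
  C y /\ exists w, y = phi (i1 :: w) /\ z = psi w).
- apply: piso_union pR pS _ _ => [y [_ [u [-> _]]] [_ [[u' [/phiI]]]] //|].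
  move=> y [_ [u [_ ->]]] [z [[v [-> Nv npv]] [v' [/phiI[<-] e]]]].
  by apply: npv; rewrite -e; apply/(chart_root _ cp); exists u.
- have := fin_genU (fin_gen_desc (phi [:: i0])) (fin_gen_fin
    (fun w : N.-tuple 'I_q => ~ desc p (psi w)) (fun w => phi (i1 :: w))).
  congr fin_gen; apply: funext => v; apply/propext; split.
    move=> [/(chart_root _ c0)[u ->]|[w npw /(chart_desc _ _ cp)[u ->]]].
      by exists (phi u); left; exists u.
    exists (psi (w ++ u)); right; split; last by exists (w ++ u).
    exists (w ++ u); split=> //; first by rewrite size_cat size_tuple leq_addr.
    by move=> /xN; rewrite take_size_cat ?size_tuple.
  move=> [y [[u [-> _]]|[[u [-> Nu npu]] _]]].
    by left; apply/(chart_root _ c0); exists u.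
  right; have sz : size (take N u) == N by rewrite size_takel.
  exists (Tuple sz) => /=.
    move=> pu; apply: npu; apply: desc_trans pu _.
    by apply/(chart_desc _ _ cx); exists (drop N u); rewrite cat_take_drop.
  by apply/(chart_desc _ _ cp); exists (drop N u); rewrite /= cat_take_drop.
exists s => //; split=> [u|u Nu npu]; apply: sR; first by left; exists u.
by right; split; exists u.
Qed.

(** Generators are absorbed one at a time, replacing [p] by [s p] from [join_aut]: below [s p] lie
    [p] and every vertex of [desc x] at depth at least [N] outside [desc p]. *)
Lemma dense_root (Q : D -> Prop) :
  inhabited D -> fin_gen Q ->
  exists p, forall v, Q v -> exists2 u, desc v u & desc p u.
Proof.
move=> [d]; elim/fin_gen_ind=> [|P x fP [p pP]]; first by exists d.
have [phi cp] := chD p; have [psi cx] := chD x.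
have [N [s siso [s0 s1]]] := join_aut cp cx.
have pE w : desc (s p) (s (phi w)).
  by apply/(is_iso_desc _ _ siso)/(chart_root _ cp); exists w.
have pp' u : desc p u -> desc (s p) u.
  by move=> /(chart_root _ cp)[w ->]; rewrite -s0.
exists (s p) => v [/pP[u vu pu]|/(chart_root _ cx)[w ->]].
  by exists u => //; apply: pp'.
(* Appending [N] letters reaches the depth from which [join_aut] applies. *)
exists (psi (w ++ nseq N i0)); first by apply/(chart_desc _ _ cx); eexists.
have [|np] := pselect (desc p (psi (w ++ nseq N i0))); first exact: pp'.
by rewrite -s1 // size_cat size_nseq leq_addl.
Qed.

(** An automorphism [s] with [s (phi [:: i0]) = p] makes [s (phi [:: i1])] a sibling of [p]. A
    vertex of [Q] below the sibling would have a descendant in [desc p], but sibling trees are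
    disjoint. *)
Lemma disjoint_vertex (Q : D -> Prop) :
  inhabited D -> fin_gen Q -> exists b, forall v, desc b v -> ~ Q v.
Proof.
move=> iD fQ; have [p pQ] := dense_root iD fQ.
have [phi cp] := chD p; have [N [s siso [s0 _]]] := join_aut cp cp.
exists (s (phi [:: i1])) => v bv /pQ[u vu].
move=> /(chart_root _ cp)[w uw]; move: vu => /(desc_trans bv).
rewrite uw -(s0 w) (is_iso_desc _ _ siso) => b1.
have b0 : desc (phi [:: i0]) (phi (i0 :: w)).
  by apply/(chart_desc _ _ cp); exists w.
by have := chart_desc_eq cp (erefl : size [:: i0] = size [:: i1]) b0 b1.
Qed.

End DisjointVertex.

(** * Vertices with common children *)

Section SharedChildren.
Variable q : nat.
Hypothesis q_gt0 : 0 < q.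
Variable G : digraph.

(** The chart of [x] supplies the trees below the common children. No [a r] lies in these trees,
    where out-neighbours have labels of length at least two. *)
Lemma Tn_embed m (x : G) chi (a : 'I_m -> G) :
  @chart q G x chi -> injective a ->
  (forall r v, edge (a r) v <-> exists i, v = chi [:: i]) ->
  exists f : Tn q m -> G, le_embedding f.
Proof.
move=> cx aI aE; have [_ chiI chiE] := cx.
have nar r j w : a r <> chi (j :: w).
  move=> e; have : edge (a r) (chi [:: Ordinal q_gt0]) by apply/aE; eexists.
  by rewrite e => /chiE[k /chiI[_]]; case: w {e}.
exists (fun t : Tn q m =>
  match t with inl r => a r | inr (i, w) => chi (i :: w) end); split.
- move=> [r|[i w]] [r'|[j w']] //.
  + by move=> /aI->.
  + by move=> /nar.
  + by move=> /esym/nar.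
  + by move=> /chiI[-> ->].
- move=> [r|[i w]] [r'|[j w']] /=.
  + by split=> // /aE[i /nar].
  + by rewrite aE; split=> [[k /chiI[_ ->]]|->] //; exists j.
  + by split=> // /chiE[k /nar].
  + rewrite chiE; split=> [[k /chiI[-> ->]]|[-> [k ->]]]; last by exists k.
    by split=> //; exists k.
- apply/desc_closedP => u v [[r|[i w]] <-].
    by move=> /aE[i ->]; exists (inr (i, [::])).
  by move=> /chiE[k ->]; exists (inr (i, rcons w k)).
Qed.

Section LeEmbedding.
Variables (m : nat) (f : Tn q m -> G).
Hypothesis fP : le_embedding f.

Lemma Tn_edge_root r v : edge (f (inl r)) v <-> exists i, v = f (inr (i, [::])).
Proof.
have [fI fE /desc_closedP cf] := fP; split=> [rv|[i ->]]; last exact/fE.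
have [|[r'|[i w]] fv] := cf _ _ _ rv; first by exists (inl r).
  by move: rv; rewrite -fv => /fE.
by move: rv; rewrite -fv => /fE /= ->; exists i.
Qed.

Lemma Tn_edge_tree i w v :
  edge (f (inr (i, w))) v <-> exists k, v = f (inr (i, rcons w k)).
Proof.
have [fI fE /desc_closedP cf] := fP; split=> [rv|[k ->]]; last first.
  by apply/fE; split=> //; exists k.
have [|[r'|[j w']] fv] := cf _ _ _ rv; first by exists (inr (i, w)).
  by move: rv; rewrite -fv => /fE.
by move: rv; rewrite -fv => /fE /= [-> [k ->]]; exists k.
Qed.

Lemma Tn_chart i : chart (f (inr (i, [::]))) (fun w => f (inr (i, w))).
Proof.
have [fI _ _] := fP; split=> //; first by move=> w w' /fI[].
exact: Tn_edge_tree.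
Qed.

(** Without its roots, the copy of [Tn] consists of [q] disjoint trees, like the proper descendants
    of [y]. Extending such a match by homogeneity will transport the roots. *)
Lemma Tn_piso (H : digraph) (y : H) chi :
  @chart q H y chi ->
  piso (fun d e => exists i w, d = f (inr (i, w)) /\ e = chi (i :: w)).
Proof.
move=> [_ chiI chiE]; have [fI fE _] := fP; split.
- by move=> d e e' [i [w [-> ->]]] [j [w' [/fI[-> ->] ->]]].
- by move=> d d' e [i [w [-> ->]]] [j [w' [-> /chiI[-> ->]]]].
- move=> d e d' e' [i [w [-> ->]]] [j [w' [-> ->]]].
  rewrite Tn_edge_tree chiE.
  by split=> -[k]; [move=> /fI[-> ->]|move=> /chiI[-> ->]]; exists k.
- move=> d e d' [i [w [-> _]]] /Tn_edge_tree[k ->].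
  by exists (chi (i :: rcons w k)), i, (rcons w k).
- move=> d e e' [i [w [_ ->]]] /chiE[k ->].
  by exists (f (inr (i, rcons w k))), i, (rcons w k).
Qed.

End LeEmbedding.

(** By pigeonhole two of the [k.+1] roots lie below the same generator; in that tree a vertex has at
    most one parent, yet the roots share a child. *)
Lemma Tn_bound :
  charted q G -> fin_gen (fun _ : G => True) ->
  exists k, ~ exists f : Tn q k.+1 -> G, le_embedding f.
Proof.
move=> chG [k [g gG]]; exists k => -[f fP]; have [fI _ _] := fP.
have hr (r : 'I_k.+1) : exists i, desc (g i) (f (inl r)) by apply/gG.
have [h hP] := choice hr.
suff hI : injective h by have := leq_card h hI; rewrite !card_ord ltnn.
move=> r r' hrr'; have := hP r; have := hP r'; rewrite -hrr'.
have [psi cg] := chG (g (h r)); have [_ psiI psiE] := cg.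
move=> /(chart_root _ cg)[w' e'] /(chart_root _ cg)[w e].
have child s : edge (f (inl s)) (f (inr (Ordinal q_gt0, [::]))).
  by apply/(Tn_edge_root fP); eexists.
have := child r; have := child r'; rewrite e e' => /psiE[i ->] /psiE[j].
by move=> /psiI/rcons_inj[ww' _]; move: e'; rewrite ww' -e => /fI[].
Qed.

End SharedChildren.

(** * Embedding members of C into [D] *)

Section Embedding.
Variables (q : nat) (A D : digraph) (m : nat).
Hypotheses (q_gt1 : 1 < q) (hD : desc_homogeneous D) (chD : charted q D).
Hypotheses (mD : meets_fg D) (iD : inhabited D).
Hypotheses (chA : charted q A) (mA : meets_fg A).
Hypothesis Tm_D : exists f : Tn q m -> D, le_embedding f.
Hypothesis Tm1_A : ~ exists f : Tn q m.+1 -> A, le_embedding f.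

Definition emb (P : A -> Prop) : Prop :=
  exists2 R : A -> D -> Prop, fg_piso R & dom R = P.

Lemma emb_ext (P Q : A -> Prop) : (forall v, P v <-> Q v) -> emb P -> emb Q.
Proof.
by move=> PQ; have -> // : P = Q by apply: funext => v; apply/propext.
Qed.

(** The new tree goes to one avoiding the image built so far, so the two pieces glue. *)
Lemma emb_disjoint (P : A -> Prop) z :
  emb P -> (forall v, desc z v -> ~ P v) -> emb (fun v => P v \/ desc z v).
Proof.
move=> [R [pR fR] dR] dzP.
have [b bR] := disjoint_vertex q_gt1 hD chD mD iD (piso_fin_gen pR fR).
have [zeta cz] := chA z; have [beta cb] := chD b.
pose S x y := exists w, x = zeta w /\ y = beta w.
have dS x : dom S x <-> desc z x.
  rewrite (chart_root _ cz); split=> [[y [w [-> _]]]|[w ->]]; first by exists w.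
  by exists (beta w), w.
have dE : dom (fun x y => R x y \/ S x y) = fun v => P v \/ desc z v.
  apply: funext => x; apply/propext; rewrite -dS -dR.
  split=> [[y [xy|xy]]|[[y xy]|[y xy]]].
  - by left; exists y.
  - by right; exists y.
  - by exists y; left.
  - by exists y; right.
exists (fun x y => R x y \/ S x y) => //; split.
  apply: piso_union => //; first exact: chart_piso cz cb.
    by move=> x Rx /dS /dzP; rewrite -dR.
  move=> y Ry [x [w [_ yw]]]; apply: bR Ry.
  by apply/(chart_root _ cb); exists w.
by rewrite dE; apply: fin_genU (fin_gen_desc z); rewrite -dR.
Qed.

(** The trees below the roots of a copy of [Tn q m] in [D] match those below the children of [x],
    which [R] carries into [D]. An automorphism extending the composite moves the [m] roots above
    the prescribed children. *)
Lemma shared_children (R : A -> D -> Prop) (x : A) chi :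
  piso R -> chart x chi -> (forall i : 'I_q, dom R (chi [:: i])) ->
  exists2 b : 'I_m -> D, injective b &
    forall r v, edge (b r) v <-> exists i, R (chi [:: i]) v.
Proof.
move=> pR cx dchi; have [f fP] := Tm_D; have [fI _ _] := fP.
have pT := Tn_piso fP cx.
have dchi' i w : dom R (chi (i :: w)).
  apply: (piso_dom_closed pR (dchi i)); apply/(chart_desc _ _ cx).
  by exists w.
have pTR := piso_comp pT pR.
have [||s siso sR] := homogeneous_extend hD (pTR _).
- by move=> y [_ [i [w [_ ->]]]].
- have := fin_gen_fin (fun=> True) (fun i : 'I_q => f (inr (i, [::]))).
  congr fin_gen; apply: funext => v; apply/propext; split.
    move=> [i _ /(chart_root _ (Tn_chart fP i))[w ->]].
    by have [y Ry] := dchi' i w; exists y, (chi (i :: w)) => //; exists i, w.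
  move=> [y [z [i [w [-> _]]] _]]; exists i => //.
  by apply/(chart_root _ (Tn_chart fP i)); exists w.
have [g [sK [gK sE]]] := siso.
exists (fun r => s (f (inl r))); first by move=> r r' /(can_inj sK)/fI[].
have sy i y : R (chi [:: i]) y -> s (f (inr (i, [::]))) = y.
  by move=> Ry; apply: sR; exists (chi [:: i]) => //; exists i, [::].
move=> r v; rewrite -{1}(gK v) sE (Tn_edge_root fP); split=> -[i].
  move=> gv; exists i; have [y Ry] := dchi i.
  by rewrite -(gK v) gv (sy _ _ Ry).
by move=> Rv; exists i; rewrite -(sy _ _ Rv) sK.
Qed.

(** If some candidate [b r] is outside the image, it can be the image of [x]. Otherwise the
    preimages of all [m] candidates have the same children as [x], and together with [x] they give a
    copy of [Tn q m.+1] in [A]. *)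
Lemma emb_vertex (P : A -> Prop) x :
  emb P -> (forall v, edge x v -> P v) -> emb (fun v => P v \/ desc x v).
Proof.
move=> eP xP; have [R [pR fR] dR] := eP.
have cP : desc_closed P by rewrite -dR; apply: piso_dom_closed.
have [Px|nPx] := pselect (P x).
  by apply: emb_ext eP => v; split=> [|[//|/(cP _ Px)]] //; left.
have [chi cx] := chA x; have [chi0 chiI chiE] := cx.
have xE v : edge x v <-> exists i, v = chi [:: i] by rewrite -chi0 chiE.
have dchi i : dom R (chi [:: i]) by rewrite dR; apply/xP/xE; exists i.
have [b bI bE] := shared_children pR cx dchi.
have [[r nRb]|allR] := pselect (exists r, ~ cod R (b r)); last first.
  case: Tm1_A.
  have ar r : exists y, R y (b r).
    by apply: contrapT => nR; apply: allR; exists r.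
  have [a Ra] := choice ar.
  (* The last of the [m.+1] roots is [x], the others are the preimages [a k]. *)
  pose a' (r : 'I_m.+1) := if unlift ord_max r is Some k then a k else x.
  have ax r : a r <> x by move=> e; apply: nPx; rewrite -dR -e; exists (b r).
  apply: (@Tn_embed q (ltnW q_gt1) A m.+1 x chi a' cx).
    move=> r r'; rewrite /a'.
    case: unliftP => [k ->|->]; case: unliftP => [k' ->|->] //.
    - move=> akk'; congr lift; apply: bI; apply: (piso_fun pR (Ra k)).
      by rewrite akk'.
    - by move=> /ax.
    - by move=> /esym/ax.
  move=> r v; rewrite /a'; case: unliftP => [k _|_]; last exact: xE.
  split=> [av|[i ->]].
    have [y vy] := piso_dom pR (Ra k) av.
    have /bE[i iy] := (piso_edge pR (Ra k) vy).1 av.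
    by exists i; apply: piso_inj vy iy.
  have [y iy] := dchi i; apply/(piso_edge pR (Ra k) iy)/bE.
  by exists i.
pose R' u v := R u v \/ (u = x /\ v = b r).
have nRx y : ~ R x y by move=> xy; apply: nPx; rewrite -dR; exists y.
have nRb' y : ~ R y (b r) by move=> yb; apply: nRb; exists y.
have to_x u y : R u y -> ~ edge u x.
  by move=> uy /(piso_dom pR uy)[y'] /nRx.
have to_b u y : R u y -> ~ edge y (b r).
  by move=> uy /(piso_cod pR uy)[y'] /nRb'.
have pR' : piso R'.
  split.
  - move=> u y y' [uy|[ux yb]] [uy'|[ux' yb']].
    + exact: (piso_fun pR uy uy').
    + by rewrite ux' in uy; case: (nRx _ uy).
    + by rewrite ux in uy'; case: (nRx _ uy').
    + by rewrite yb yb'.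
  - move=> u u' y [uy|[ux yb]] [uy'|[ux' yb']].
    + exact: (piso_inj pR uy uy').
    + by rewrite yb' in uy; case: (nRb' _ uy).
    + by rewrite yb in uy'; case: (nRb' _ uy').
    + by rewrite ux ux'.
  - move=> u y u' y' [uy|[-> ->]] [uy'|[-> ->]].
    + exact: (piso_edge pR uy uy').
    + by split=> [/(to_x _ _ uy)|/(to_b _ _ uy)].
    + rewrite xE bE; split=> -[i]; first by move=> e; exists i; rewrite -e.
      by move=> /(piso_inj pR uy') ->; exists i.
    + split=> [/xP|] //.
      by move=> /bE[i] /nRb'.
  - move=> u y u' [uy|[-> _]].
      by move=> /(piso_dom pR uy)[y' ?]; exists y'; left.
    by move=> /xP; rewrite -dR => -[y' ?]; exists y'; left.
  - move=> u y y' [uy|[_ ->]].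
      by move=> /(piso_cod pR uy)[u' ?]; exists u'; left.
    by move=> /bE[i ?]; exists (chi [:: i]); left.
have dE : dom R' = fun v => P v \/ desc x v.
  apply: funext => v; apply/propext; rewrite -dR; split.
    move=> [y [vy|[-> _]]]; first by left; exists y.
    by right; apply: desc_refl.
  move=> [[y vy]|xv]; first by exists y; left.
  by apply: (piso_dom_closed pR') xv; exists (b r); right.
exists R' => //; split=> //.
by rewrite dE; apply: fin_genU (fin_gen_desc x); rewrite -dR.
Qed.

(** Induction on the depth at which every subtree is inside [P] or disjoint from it: first the trees
    below the children are added one by one, then [x] itself by [emb_vertex]. *)
Lemma emb_level N x chi (P : A -> Prop) :
  chart x chi -> emb P ->
  (forall w : seq 'I_q, size w = N ->
    P (chi w) \/ forall v, desc (chi w) v -> ~ P v) ->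
  emb (fun v => P v \/ desc x v).
Proof.
elim: N x chi P => [|N IH] x chi P cx eP dich; have [chi0 chiI chiE] := cx.
  have [] := dich [::] erefl; rewrite chi0 => h; last exact: emb_disjoint.
  have [R [pR _] dR] := eP.
  apply: emb_ext eP => v; split=> [|[//|xv]]; first by left.
  by move: h; rewrite -dR => /(piso_dom_closed pR); apply.
have step (s : seq 'I_q) : uniq s ->
    emb (fun v => P v \/ exists2 i, i \in s & desc (chi [:: i]) v).
  elim: s => [_|j s IHs /= /andP[js us]].
    by apply: emb_ext eP => v; split=> [|[//|[]//]]; left.
  have := IH _ _ _ (chart_sub [:: j] cx) (IHs us) => /= IHj.
  apply: emb_ext (IHj _) => [v|w wN].
    split=> [[[Pv|[i si iv]]|jv]|[Pv|[i]]].
    - by left.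
    - by right; exists i; rewrite // in_cons si orbT.
    - by right; exists j; rewrite ?mem_head.
    - by left; left.
    - by move=> /predU1P[->|si] iv; [right|left; right; exists i].
  (* The dichotomy survives the trees already added, since those hang below siblings of [chi
     [:: j]]. *)
  have [|Pw|nPw] := dich (j :: w); [by rewrite /= wN|by left; left|].
  right=> v wv [/(nPw _ wv)//|[i si iv]].
  have jv : desc (chi [:: j]) v.
    by apply: desc_trans wv; apply/(chart_desc _ _ cx); exists w.
  have [ij] := chart_desc_eq cx (erefl : size [:: i] = size [:: j]) iv jv.
  by rewrite ij (negbTE js) in si.
have := emb_vertex (step _ (enum_uniq 'I_q)) => /(_ x) eX.
apply: emb_ext (eX _) => v.
  split=> [[[Pv|[i _ iv]]|xv]|[Pv|xv]]; try by [left|right|left; left].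
  right; apply: desc_trans iv; apply/(chart_root _ cx); by eexists.
rewrite -chi0 => /chiE[i ->]; right; exists i; rewrite ?mem_enum //.
exact: desc_refl.
Qed.

(** At the depth [N] given by [fin_gen_meet], a vertex outside [P] has no descendant in [P], which
    is the dichotomy required by [emb_level]. *)
Lemma emb_all : fin_gen (fun _ : A => True) -> emb (fun=> True).
Proof.
elim/fin_gen_ind=> [|P x fP eP].
  exists (fun _ _ => False); first exact: piso_empty.
  by apply: funext => v; apply/propext; split=> // -[].
have [chi cx] := chA x; have [N xN] := fin_gen_meet mA cx fP.
apply: (emb_level (N := N) cx eP) => w wN.
have [|nPw] := pselect (P (chi w)); [by left|right=> v].
move=> /(chart_desc _ _ cx)[u ->] /xN.
by rewrite take_size_cat.
Qed.

End Embedding.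

(** * Determination of the age and conclusion *)

Lemma fin_gen_sub (G : digraph) (A Q : G -> Prop) :
  desc_closed A -> fin_gen Q -> (forall v, Q v -> A v) ->
  fin_gen (fun x : sub A => Q (proj1_sig x)).
Proof.
move=> cA fQ QA.
have pR := piso_restr (piso_inv (piso_sub cA)) (fin_gen_closed fQ).
have := piso_fin_gen pR.
have -> : dom (fun y (x : sub A) => Q y /\ proj1_sig x = y) = Q.
  apply: funext => v; apply/propext; split=> [[x []] //|Qv].
  by exists (exist _ v (QA _ Qv)).
move/(_ fQ); congr fin_gen; apply: funext => x; apply/propext.
by split=> [[y [Qy ->]]|Qx] //; exists (proj1_sig x).
Qed.

Lemma charted_sub q (G : digraph) (A : G -> Prop) :
  desc_closed A -> charted q G -> charted q (sub A).
Proof.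
move=> cA chG a; have [psi ca] := chG (proj1_sig a).
have Apsi w : exists y : sub A, proj1_sig y = psi w.
  have aw : desc (proj1_sig a) (psi w) by apply/(chart_root _ ca); exists w.
  by exists (exist _ _ (cA _ (proj2_sig a) _ aw)).
have [psi' psi'E] := choice Apsi; have [psi0 psiI psiE] := ca.
exists psi'; split.
- by apply: sub_val_inj; rewrite psi'E.
- by move=> w w' e; apply: psiI; rewrite -!psi'E e.
- move=> w v; rewrite -[edge _ _]/(edge (proj1_sig (psi' w)) (proj1_sig v)).
  rewrite psi'E psiE; split=> -[i vE]; exists i.
    by apply: sub_val_inj; rewrite psi'E.
  by rewrite vE psi'E.
Qed.

Lemma inC_sub q (D : digraph) (A : D -> Prop) :
  charted q D -> meets_fg D -> desc_closed A -> fin_gen A -> inC q (sub A).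
Proof.
move=> chD mD cA fA; split.
- by move=> a; apply/chartP; apply: charted_sub.
- have := fin_gen_sub cA fA (fun _ Av => Av).
  congr fin_gen; apply: funext => x; apply/propext; split=> // _.
  exact: proj2_sig.
- move=> a b; have := fin_gen_sub cA (mD (proj1_sig a) (proj1_sig b)).
  move/(_ (fun v h => cA _ (proj2_sig a) _ h.1)).
  congr fin_gen; apply: funext => x; apply/propext.
  by rewrite !desc_sub.
Qed.

Lemma le_embedding_sub (T D : digraph) (A : D -> Prop) (f : T -> sub A) :
  desc_closed A -> le_embedding f -> le_embedding (fun x => proj1_sig (f x)).
Proof.
move=> /desc_closedP cA [fI fE /desc_closedP cf]; split=> //.
  by move=> x y /sub_val_inj/fI.
apply/desc_closedP => _ b [x <-] xb.
have [|y fy] := cf (f x) (exist _ b (cA _ _ (proj2_sig (f x)) xb)) _ xb.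
  by exists x.
by exists y; rewrite fy.
Qed.

Lemma emb_iso (A D : digraph) :
  emb D (fun _ : A => True) ->
  exists2 B : D -> Prop, desc_closed B /\ fin_gen B & iso (sub B) A.
Proof.
move=> [R [pR fR] dR]; exists (cod R).
  by split; [apply: piso_cod_closed|apply: piso_fin_gen].
have [f [g [fK [gK fE]]] Rf] := piso_sub_iso pR.
have dA x : dom R x by rewrite dR.
exists (fun y => proj1_sig (g y)), (fun x => f (exist _ x (dA x))); split.
  move=> y; rewrite -[RHS]gK; congr f; exact: sub_val_inj.
split; first by move=> x; rewrite fK.
move=> x y; rewrite -[edge (proj1_sig _) _]/(edge (g x) (g y)).
by rewrite -fE !gK.
Qed.

Theorem theorem2p5 (q : nat) (D : digraph) :
  2 <= q ->
  inhabited D ->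
  countable_digraph D ->
  desc_homogeneous D ->
  (forall v : D, iso (sub (desc v)) (Ttree q)) ->
  exists n : option nat,
    (forall m, n = Some m -> 2 <= m) /\ iso_to_Dn q n D.
Proof.
move=> q_gt1 iD cD hD isoD; have q_gt0 := ltnW q_gt1.
have chD : charted q D by move=> a; apply/chartP.
have mD := homogeneous_meets_fg cD hD chD.
pose TnD n := exists f : Tn q n -> D, le_embedding f.
have embC A m : inC q A -> TnD m ->
    ~ (exists f : Tn q m.+1 -> A, le_embedding f) ->
    exists2 B : D -> Prop, desc_closed B /\ fin_gen B & iso (sub B) A.
  move=> [isoA fA mA] Tm nTm; apply: emb_iso.
  by apply: emb_all Tm nTm fA => // a; apply/chartP.
(* Uniqueness follows from the age: digraphs with the same age contain copies of each other's
   finitely generated closed subdigraphs, as back-and-forth requires. *)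
suff [n n_ge2 ageD] : exists2 n : option nat,
    forall m, n = Some m -> 2 <= m & age_is q n D.
  exists n; split=> //; split=> // E cE hE ageE.
  apply: back_and_forth => // A cA fA.
    by apply: ageE.2; apply: ageD.1.
  by apply: ageD.2; apply: ageE.1.
(* A single vertex with its tree is already a copy of [Tn q 1]; this forces the least excluded index
   to be at least 2. *)
have TnD01 n : n <= 1 -> TnD n.
  case: iD => x n1; have [psi cx] := chD x.
  apply: (Tn_embed q_gt0 (a := fun=> x) cx).
    by move=> [r rn] [s sn] _; apply: val_inj => /=;
      case: r s rn sn => [|r] [|s]; case: n n1 => [|[]].
  by have [<- _ psiE] := cx => r v; apply: psiE.
have [exN|allN] := pselect (exists n, ~ TnD n); last first.
  exists None => //; split=> [A cA fA|A [inCA _]].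
    by split=> //; apply: inC_sub.
  have [isoA fA mA] := inCA.
  have chA : charted q A by move=> a; apply/chartP.
  (* Each [A] excludes some [Tn q k.+1] of its own, while [D] contains [Tn q k], so [embC] applies
     with [m] equal to [k]. *)
  have [k nk] := Tn_bound q_gt0 chA fA.
  apply: embC nk => //; apply: contrapT => nT.
  by apply: allN; exists k.
have exN' : exists n, `[< ~ TnD n >] by have [n ?] := exN; exists n; apply/asboolP.
(* The least excluded index is written [m.+1], so that [D] contains [Tn q m] and [embC] applies. *)
case: (ex_minnP exN') => -[|m] /asboolP nT minT; first by case: nT; apply: TnD01.
have Tm : TnD m.
  by apply: contrapT => /asboolP /minT; rewrite ltnn.
exists (Some m.+1) => [_ [<-]|].
  by rewrite ltnS lt0n; apply/eqP => m0; apply: nT; apply: TnD01; rewrite m0.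
split=> [A cA fA|A [inCA nTA]]; last exact: embC Tm nTA.
split; first exact: inC_sub.
by move=> [f fP]; apply: nT; exists (fun x => proj1_sig (f x)); apply: le_embedding_sub.
Qed.
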